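(* Let $G$ and $H$ be transitive permutation groups on finite sets $\Gamma$ and $\Delta$ respectively, and let $\Pi$ be a $(G\times H)$-invariant partition of $\Gamma\times\Delta$. Let $P_G,F_G$ be the $G$-projection and $G$-fibre partitions of $\Gamma$, and $P_H,F_H$ the $H$-projection and $H$-fibre partitions of $\Delta$, induced by $\Pi$. (1) $P_G$ and $F_G$ are $G$-invariant, and $F_G$ is a refinement of $P_G$. (2) The number $k$ of parts of $F_G$ contained in a part of $P_G$ is equal to the number of parts of $F_H$ contained in a part of $P_H$. (3) If $k=1$, then $\Pi$ is the cartesian product of a $G$-invariant partition of $\Gamma$ and an $H$-invariant partition of $\Delta$. (4) If $k>1$, then for any part $A\times B$ of $P_G\times P_H$, the set of $k^2$ parts of $F_G\times F_H$ contained in $A\times B$ has the structure of a Latin square, where the first and second coordinates define the square grid and the parts of $\Pi$ give the positions of the letters; that is, each part of $F_G\times F_H$ is contained in a unique part of $\Pi$, and each part of $\Pi$ contained in $A\times B$ contains exactly one part of $F_G\times F_H$ in each row and exactly one in each column of the $k\times k$ grid formed by the parts $a\times b$, with $a\subseteq A$ a part of $F_G$ and $b\subseteq B$ a part of $F_H$.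
   Context: $G\times H$ acts on $\Gamma\times\Delta$ by $(\gamma,\delta)(g,h)=(\gamma g,\delta h)$. A partition is invariant under a group if every group element maps each part onto a part. The $G$-projection partition of $\Gamma$ has as its parts the sets $P_0=\{\gamma\in\Gamma:(\exists\delta\in\Delta)\,(\gamma,\delta)\in P\}$ for $P$ a part of $\Pi$ (these form a partition of $\Gamma$). The $G$-fibre partition of $\Gamma$ is obtained by fixing $\delta\in\Delta$: its parts are the non-empty sets $\{\gamma\in\Gamma:(\gamma,\delta)\in P\}$ for $P$ a part of $\Pi$ (this is independent of the choice of $\delta$). The $H$-projection and $H$-fibre partitions of $\Delta$ are defined in the same way with the two coordinates exchanged. A partition $\Pi_1$ refines $\Pi_2$ if every part of $\Pi_2$ is a union of parts of $\Pi_1$. The cartesian product $\Pi_1\times\Pi_2$ of partitions of $\Gamma$ and $\Delta$ is the partition of $\Gamma\times\Delta$ whose parts are the products of a part of $\Pi_1$ and a part of $\Pi_2$. *)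

(* Defs.v *)
From HB Require Import structures.
From mathcomp Require Import all_boot all_fingroup.

Set Implicit Arguments.
Unset Strict Implicit.
Unset Printing Implicit Defensive.

Local Open Scope group_scope.

Section ProductAction.

Variables Gamma Delta : finType.

Definition prod_perm (x : Gamma * Delta) (a : {perm Gamma} * {perm Delta}) :
  Gamma * Delta := (aperm x.1 a.1, aperm x.2 a.2).

Lemma prod_perm1 x : prod_perm x 1 = x.
Proof. by case: x => x y; rewrite /prod_perm /= /aperm !perm1. Qed.

Lemma prod_permM x a b : prod_perm x (a * b) = prod_perm (prod_perm x a) b.
Proof. by rewrite /prod_perm /= /aperm !permM. Qed.

Definition prod_action : {action {perm Gamma} * {perm Delta} &-> Gamma * Delta} :=
  TotalAction prod_perm1 prod_permM.

End ProductAction.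

Section Partitions.

Variable T : finType.

Definition invariant_partition (aT : finGroupType) (to : {action aT &-> T})
    (A : {set aT}) (Pi : {set {set T}}) : bool :=
  partition Pi [set: T] && [acts A, on Pi | to^*].

Definition refines (Pi1 Pi2 : {set {set T}}) : Prop :=
  forall P, P \in Pi2 -> exists2 Q : {set {set T}}, Q \subset Pi1 & P = cover Q.

End Partitions.

Section InducedPartitions.

Variables Gamma Delta : finType.

Definition cartesian_product
    (Pi1 : {set {set Gamma}}) (Pi2 : {set {set Delta}}) :
    {set {set Gamma * Delta}} :=
  [set setX A B | A in Pi1, B in Pi2].

Variable Pi : {set {set Gamma * Delta}}.

Definition projG : {set {set Gamma}} :=
  [set [set x | [exists y, (x, y) \in P]] | P : {set Gamma * Delta} in Pi].

Definition projH : {set {set Delta}} :=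
  [set [set y | [exists x, (x, y) \in P]] | P : {set Gamma * Delta} in Pi].

(* For invariant Pi under a product of transitive groups, the fibre partitions
   do not depend on the base point y0 (resp. x0). *)
Definition fibreG (y0 : Delta) : {set {set Gamma}} :=
  [set [set x | (x, y0) \in P] | P : {set Gamma * Delta} in Pi] :\ set0.

Definition fibreH (x0 : Gamma) : {set {set Delta}} :=
  [set [set y | (x0, y) \in P] | P : {set Gamma * Delta} in Pi] :\ set0.

End InducedPartitions.

(* Main.v *)
Require Import Defs.
From HB Require Import structures.
From mathcomp Require Import all_boot all_fingroup.

Set Implicit Arguments.
Unset Strict Implicit.
Unset Printing Implicit Defensive.

Local Open Scope group_scope.

(** Write [E] for the relation of lying in the same part of [Pi].  Moving only
    the second coordinate, by an element of [H], preserves [E], and [H] is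
    transitive; so every instance [E (x, y) (x', y')] can be transported to any
    prescribed value of [y], at the cost of changing [y'] but not [x] and [x'].
    Hence the fibre relation [E (x, y) (x', y)] does not depend on [y], and the
    projection relation, that [E (x, y) (x', y')] for some [y] and [y'], is
    transitive.  The same holds with the coordinates exchanged
    ([homogeneous_flip]), and the fibre and projection partitions are the
    partitions into classes of these relations ([projG_classes] to
    [fibreH_classes]).

    The heart of the matter is [fibre_corner]: if [(x, y)] and [(x', y')] lie in
    one part of [Pi], then [x] and [x'] are fibre equivalent if and only if [y]
    and [y'] are, because either condition says that the corner [(x', y)] lies
    in that part too.  So a part [P] of [Pi] with projections [A] and [B]
    induces a bijection between the fibre parts in [A] and those in [B].  Any
    [A] and [B] occur as the projections of some [P], namely of the part of any
    point of [A * B]; therefore all these numbers of fibre parts equal one [k]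
    ([card_fibre_parts]).  The graph of this bijection consists of the cells
    of the grid contained in [P], which is the Latin square property
    ([latin_row]).  For [k = 1] the grid is a single cell, and
    [A * B = P] ([product_of_single_cells]). *)

(** * Partitions into classes of an equivalence relation *)

Section Classes.

Variable T : finType.
Implicit Types (R : rel T) (x y : T).

Definition eqclass R x : {set T} := [set y | R x y].

Definition eqclasses R : {set {set T}} := equivalence_partition R [set: T].

Lemma eqclassesP R (P : {set T}) :
  reflect (exists x, P = eqclass R x) (P \in eqclasses R).
Proof.
have cE x : [set y in [set: T] | R x y] = eqclass R x.
  by apply/setP=> y; rewrite !inE.
apply: (iffP imsetP) => [[x _ ->]|[x ->]]; first by exists x; rewrite cE.
by exists x; rewrite ?inE ?cE.
Qed.

Lemma mem_eqclasses R x : eqclass R x \in eqclasses R.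
Proof. by apply/eqclassesP; exists x. Qed.

Section Equivalence.

Variable R : rel T.
Hypothesis eqvR : equivalence_rel R.

Lemma eqv_refl x : R x x.
Proof. by have [] := eqvR x x x. Qed.

Lemma eqv_sym x y : R x y = R y x.
Proof.
have sym u v : R u v -> R v u.
  by move=> Ruv; have [_ /(_ Ruv) <-] := eqvR u v u; apply: eqv_refl.
by apply/idP/idP; apply: sym.
Qed.

Lemma eqv_trans y x z : R x y -> R y z -> R x z.
Proof. by move=> Rxy Ryz; have [_ ->] := eqvR x y z. Qed.

Lemma eqclass_eq x y : R x y -> eqclass R x = eqclass R y.
Proof. by move=> Rxy; apply/setP=> z; rewrite !inE; have [_ ->] := eqvR x y z. Qed.

Lemma eqclass_inj x y : eqclass R x = eqclass R y -> R x y.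
Proof. by move/setP/(_ y); rewrite !inE eqv_refl. Qed.

Lemma mem_eqclass x : x \in eqclass R x.
Proof. by rewrite inE eqv_refl. Qed.

Lemma eqclasses_mem (P : {set T}) x : P \in eqclasses R -> x \in P -> P = eqclass R x.
Proof. by case/eqclassesP=> y ->; rewrite inE; apply: eqclass_eq. Qed.

Lemma set0_eqclasses : set0 \notin eqclasses R.
Proof.
by apply/eqclassesP=> -[x /setP/(_ x)]; rewrite mem_eqclass inE.
Qed.

Lemma eqclasses_invariant (aT : finGroupType) (to : {action aT &-> T})
    (A : {group aT}) :
    (forall a x y, a \in A -> R x y -> R (to x a) (to y a)) ->
  invariant_partition to A (eqclasses R).
Proof.
move=> invR; apply/andP; split.
  by apply: equivalence_partitionP => x y z _ _ _; apply: eqvR.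
apply/subsetP=> a Aa; rewrite !inE; apply/subsetP=> P /eqclassesP[x ->].
rewrite inE; apply/eqclassesP; exists (to x a); apply/setP=> y.
rewrite inE; apply/imsetP/idP=> [[z]|Rxy].
  by rewrite inE => Rxz ->; apply: invR.
exists (to y a^-1); last by rewrite actKV.
by rewrite inE -[x](actK to a); apply: invR; rewrite ?groupV.
Qed.

End Equivalence.

Lemma eqclass_sub (R S : rel T) x y :
    equivalence_rel R -> equivalence_rel S -> subrel R S ->
  (eqclass R x \subset eqclass S y) = S y x.
Proof.
move=> eqvR eqvS sRS; apply/subsetP/idP=> [/(_ x)|Syx z].
  by rewrite mem_eqclass // inE; apply.
by rewrite !inE => /sRS; apply: (eqv_trans eqvS).
Qed.

Lemma eqclasses_refine (R S : rel T) :
    equivalence_rel R -> equivalence_rel S -> subrel R S ->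
  refines (eqclasses R) (eqclasses S).
Proof.
move=> eqvR eqvS sRS P /eqclassesP[x ->]; exists (eqclasses R ::&: eqclass S x).
  by apply/subsetP=> Q /setIdP[].
apply/setP=> y; apply/idP/bigcupP=> [|[Q /setIdP[_ /subsetP sQ] Qy]].
  rewrite inE => Sxy; exists (eqclass R y); last exact: mem_eqclass.
  by rewrite inE mem_eqclasses eqclass_sub.
exact: sQ.
Qed.

End Classes.

(** * Homogeneous equivalence relations on a product *)

(** What the transitivity of the two groups amounts to for the relation of
    lying in one part: each coordinate can be moved anywhere by a map that
    fixes the other coordinate and preserves the relation. *)
Definition homogeneous (Gamma Delta : finType) (E : rel (Gamma * Delta)) : Prop :=
  [/\ equivalence_rel E,
      forall x z, exists2 g : Gamma -> Gamma, g x = z &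
        forall u v, E u v -> E (g u.1, u.2) (g v.1, v.2)
    & forall y z, exists2 h : Delta -> Delta, h y = z &
        forall u v, E u v -> E (u.1, h u.2) (v.1, h v.2)].

Definition flip_rel (Gamma Delta : finType) (E : rel (Gamma * Delta)) :
  rel (Delta * Gamma) := fun u v => E (u.2, u.1) (v.2, v.1).

Definition fibre_rel (Gamma Delta : finType) (E : rel (Gamma * Delta)) y :
  rel Gamma := fun x x' => E (x, y) (x', y).

Definition proj_rel (Gamma Delta : finType) (E : rel (Gamma * Delta)) :
  rel Gamma := fun x x' => [exists y, exists y', E (x, y) (x', y')].

Lemma homogeneous_flip (Gamma Delta : finType) (E : rel (Gamma * Delta)) :
  homogeneous E -> homogeneous (flip_rel E).
Proof.
case=> eqvE movG movH; split=> [u v w|y z|x z]; first exact: eqvE.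
  by have [h hyz hE] := movH y z; exists h => // u v; apply: hE.
by have [g gxz gE] := movG x z; exists g => // u v; apply: gE.
Qed.

Section Homogeneous.

Variables (Gamma Delta : finType) (E : rel (Gamma * Delta)).
Hypothesis homE : homogeneous E.
Implicit Types (x : Gamma) (y : Delta).

Let eqvE : equivalence_rel E. Proof. by case: homE. Qed.

Lemma fibre_eqv y : equivalence_rel (fibre_rel E y).
Proof. by move=> x x' x''; apply: eqvE. Qed.

(** Move [y] to [z] by a map that fixes the first coordinate. *)
Lemma fibre_indep z y x x' : fibre_rel E y x x' -> fibre_rel E z x x'.
Proof.
case: homE => _ _ /(_ y z)[h hyz hE] /hE /=.
by rewrite /fibre_rel hyz.
Qed.

Lemma proj_at y x x' : proj_rel E x x' -> exists y', E (x, y) (x', y').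
Proof.
case/existsP=> z /existsP[z' Exx']; case: homE => _ _ /(_ z y)[h <- hE].
by exists (h z'); apply: (hE _ _ Exx').
Qed.

Lemma proj_intro y y' x x' : E (x, y) (x', y') -> proj_rel E x x'.
Proof. by move=> Exx'; apply/existsP; exists y; apply/existsP; exists y'. Qed.

Lemma fibre_proj y : subrel (fibre_rel E y) (proj_rel E).
Proof. by move=> x x'; apply: proj_intro. Qed.

(** Transitivity is where homogeneity enters: the second instance of [E] has to
    be moved so as to start at the point where the first one ends. *)
Lemma proj_eqv (y0 : Delta) : equivalence_rel (proj_rel E).
Proof.
have trans x' x x'' : proj_rel E x x' -> proj_rel E x' x'' -> proj_rel E x x''.
  case/(proj_at y0)=> y' Exx' /(proj_at y')[y'' Ex'x''].
  exact: (proj_intro (eqv_trans eqvE Exx' Ex'x'')).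
have sym x x' : proj_rel E x x' -> proj_rel E x' x.
  by case/(proj_at y0)=> y'; rewrite eqv_sym //; apply: proj_intro.
move=> x x' x''; split=> [|Pxx'].
  by apply: (@proj_intro y0 y0); apply: eqv_refl.
by apply/idP/idP; apply: trans => //; apply: sym.
Qed.

End Homogeneous.

(** * The grid of fibre parts *)

Section Grid.

Variables (Gamma Delta : finType) (E : rel (Gamma * Delta)).
Hypothesis homE : homogeneous E.
Variables (x0 : Gamma) (y0 : Delta).

Let E' := flip_rel E.
Let homE' : homogeneous E' := homogeneous_flip homE.
Let eqvE : equivalence_rel E. Proof. by case: homE. Qed.

Let fG := fibre_rel E y0.
Let fH := fibre_rel E' x0.
Let pG := proj_rel E.
Let pH := proj_rel E'.
Let eqv_fG : equivalence_rel fG := fibre_eqv homE y0.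
Let eqv_fH : equivalence_rel fH := fibre_eqv homE' x0.
Let eqv_pG : equivalence_rel pG := proj_eqv homE y0.
Let eqv_pH : equivalence_rel pH := proj_eqv homE' x0.

Lemma proj_introH x x' y y' : E (x, y) (x', y') -> pH y y'.
Proof. by move=> Exx'; apply: (@proj_intro _ _ E' x x'). Qed.

Lemma grid_cell x x' y y' : fG x x' -> fH y y' -> E (x, y) (x', y').
Proof.
move/(fibre_indep homE y) => Fx /(fibre_indep homE' x') Fy.
exact: (eqv_trans eqvE Fx Fy).
Qed.

(** Both sides say that the corner [(x', y)] lies in the common part of
    [(x, y)] and [(x', y')]. *)
Lemma fibre_corner x x' y y' : E (x, y) (x', y') -> fG x x' = fH y y'.
Proof.
move=> Exx'; apply/idP/idP=> [/(fibre_indep homE y) Fx | /(fibre_indep homE' x') Fy].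
  apply: (fibre_indep homE' x0 (y := x')).
  by apply: (eqv_trans eqvE _ Exx'); rewrite (eqv_sym eqvE).
apply: (fibre_indep homE y0 (y := y)).
by apply: (eqv_trans eqvE Exx'); rewrite (eqv_sym eqvE).
Qed.

Lemma cell_sub x y u : (setX (eqclass fG x) (eqclass fH y) \subset eqclass E u)
  = E u (x, y).
Proof.
apply/subsetP/idP=> [/(_ (x, y))|Euxy [x' y']].
  by rewrite !inE (eqv_refl eqv_fG) (eqv_refl eqv_fH); apply.
rewrite !inE => /andP[fx fy]; apply: (eqv_trans eqvE Euxy).
exact: grid_cell.
Qed.

(** The part of [(x, y)], where [x] lies in [A] and [y] in [B], sends a fibre
    part [a] inside [A] to the set of all [y'] that it relates to some point of
    [a]; by [fibre_corner] this is a fibre part inside [B], and it determines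
    [a]. *)
Lemma leq_card_fibre_parts (A : {set Gamma}) (B : {set Delta}) :
    A \in eqclasses pG -> B \in eqclasses pH ->
  #|eqclasses fG ::&: A| <= #|eqclasses fH ::&: B|.
Proof.
case/eqclassesP=> x -> /eqclassesP[y ->].
pose phi (a : {set Gamma}) := [set y' | [exists x' in a, E (x, y) (x', y')]].
have phiE x' y' : E (x, y) (x', y') -> phi (eqclass fG x') = eqclass fH y'.
  move=> Exy; apply/setP=> y''; rewrite !inE.
  apply/exists_inP/idP=> [[x'']|fy].
    rewrite inE => fx Exy'; rewrite -(@fibre_corner x' x'') //.
    by apply: (eqv_trans eqvE _ Exy'); rewrite (eqv_sym eqvE).
  exists x'; first exact: mem_eqclass.
  by apply: (eqv_trans eqvE Exy); apply: grid_cell; rewrite ?(eqv_refl eqv_fG).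
have partP a : a \in eqclasses fG ::&: eqclass pG x ->
    exists x' y', a = eqclass fG x' /\ E (x, y) (x', y').
  case/setIdP=> /eqclassesP[x' ->].
  rewrite (eqclass_sub _ _ eqv_fG eqv_pG (fibre_proj (y := y0))).
  by case/(proj_at homE y)=> y' Exy; exists x', y'.
rewrite -(@card_in_imset _ _ phi) => [|a1 a2].
  apply/subset_leq_card/subsetP=> _ /imsetP[_ /partP[x' [y' [-> Exy]]] ->].
  rewrite (phiE _ _ Exy) inE mem_eqclasses.
  rewrite (eqclass_sub _ _ eqv_fH eqv_pH (fibre_proj (y := x0))).
  exact: proj_introH Exy.
move=> /partP[x1 [y1 [-> E1]]] /partP[x2 [y2 [-> E2]]].
rewrite (phiE _ _ E1) (phiE _ _ E2) => /(eqclass_inj eqv_fH) fy.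
apply: (eqclass_eq eqv_fG); rewrite (@fibre_corner _ _ y1 y2) //.
by apply: (eqv_trans eqvE _ E2); rewrite (eqv_sym eqvE).
Qed.

(** The column of the row [a] in which the part of [u] has its cell is found
    by following that part to a point over [a]; two candidate columns agree by [fibre_corner]. *)
Lemma latin_row (u : Gamma * Delta) (a : {set Gamma}) :
    a \in eqclasses fG ::&: eqclass pG u.1 ->
  exists! b, b \in eqclasses fH ::&: eqclass pH u.2
             /\ setX a b \subset eqclass E u.
Proof.
case: u => x y /= /setIdP[/eqclassesP[x' ->]].
rewrite (eqclass_sub _ _ eqv_fG eqv_pG (fibre_proj (y := y0))).
case/(proj_at homE y)=> y' Exy; exists (eqclass fH y'); split.
  rewrite cell_sub inE mem_eqclasses; split=> //.
  rewrite (eqclass_sub _ _ eqv_fH eqv_pH (fibre_proj (y := x0))).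
  exact: proj_introH Exy.
move=> b [/setIdP[/eqclassesP[y'' ->] _]]; rewrite cell_sub => Exy'.
apply: (eqclass_eq eqv_fH); rewrite -(@fibre_corner x' x').
  exact: eqv_refl.
by apply: (eqv_trans eqvE _ Exy'); rewrite (eqv_sym eqvE).
Qed.

(** A part of [E] always lies in the product of its projections; when the
    latter consists of one cell, it lies in that part. *)
Lemma product_of_single_cells :
    (forall A, A \in eqclasses pG -> #|eqclasses fG ::&: A| = 1%N) ->
    (forall B, B \in eqclasses pH -> #|eqclasses fH ::&: B| = 1%N) ->
  eqclasses E = cartesian_product (eqclasses pG) (eqclasses pH).
Proof.
move=> cardG cardH.
have single (T : finType) (f p : rel T) x x' :
    equivalence_rel f -> equivalence_rel p -> subrel f p ->
    #|eqclasses f ::&: eqclass p x| = 1%N -> p x x' -> f x x'.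
  move=> eqvf eqvp sfp /eqP/cards1P[c cE] pxx'; apply: (eqclass_inj eqvf).
  have inc z : p x z -> eqclass f z = c.
    by move=> pxz; apply/set1P; rewrite -cE inE mem_eqclasses eqclass_sub.
  by rewrite !inc ?(eqv_refl eqvp).
have productE x y : eqclass E (x, y) = setX (eqclass pG x) (eqclass pH y).
  apply/setP=> -[x' y']; rewrite !inE; apply/idP/andP=> [Exy|[px py]].
    by split; [apply: proj_intro Exy | apply: proj_introH Exy].
  apply: grid_cell.
    exact: single eqv_fG eqv_pG (fibre_proj (y := y0)) (cardG _ (mem_eqclasses _ _)) px.
  exact: single eqv_fH eqv_pH (fibre_proj (y := x0)) (cardH _ (mem_eqclasses _ _)) py.
apply/setP=> P; apply/eqclassesP/imset2P=> [[[x y] ->]|[A B]].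
  by exists (eqclass pG x) (eqclass pH y); rewrite ?mem_eqclasses ?productE.
by move=> /eqclassesP[x ->] /eqclassesP[y ->] ->; exists (x, y); rewrite productE.
Qed.

End Grid.

(** The two inequalities are instances of one lemma, for [E] and for [E] with
    the coordinates exchanged. *)
Lemma card_fibre_parts (Gamma Delta : finType) (E : rel (Gamma * Delta))
    (x0 : Gamma) (y0 : Delta) (A : {set Gamma}) (B : {set Delta}) :
    homogeneous E ->
    A \in eqclasses (proj_rel E) -> B \in eqclasses (proj_rel (flip_rel E)) ->
  #|eqclasses (fibre_rel E y0) ::&: A|
    = #|eqclasses (fibre_rel (flip_rel E) x0) ::&: B|.
Proof.
move=> homE projA projB; apply/eqP; rewrite eqn_leq leq_card_fibre_parts //=.
apply: (leq_card_fibre_parts (E := flip_rel E)) => //; exact: homogeneous_flip.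
Qed.

(** Non-emptiness of the parts makes a product of two of them determine both
    factors, and inclusion of products equivalent to inclusion of factors. *)
Lemma card_cartesian_parts (Gamma Delta : finType)
    (F : {set {set Gamma}}) (F' : {set {set Delta}})
    (A : {set Gamma}) (B : {set Delta}) :
    set0 \notin F -> set0 \notin F' ->
  #|cartesian_product F F' ::&: setX A B| = (#|F ::&: A| * #|F' ::&: B|)%N.
Proof.
move=> nF0 nF'0.
have setX_sub (a a' : {set Gamma}) (b b' : {set Delta}) :
    a \in F -> b \in F' -> setX a b \subset setX a' b' ->
    (a \subset a') && (b \subset b').
  move=> Fa Fb /subsetP sub.
  have /set0Pn[x ax] : a != set0 by apply: contraNneq nF0 => <-.
  have /set0Pn[y b_y] : b != set0 by apply: contraNneq nF'0 => <-.
  apply/andP; split; apply/subsetP=> z zin.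
    by have := sub (z, y); rewrite !inE zin b_y => /(_ isT)/andP[].
  by have := sub (x, z); rewrite !inE zin ax => /(_ isT)/andP[].
have -> : cartesian_product F F' ::&: setX A B
    = [set setX ab.1 ab.2 | ab in setX (F ::&: A) (F' ::&: B)].
  apply/setP=> C; apply/setIdP/imsetP=> [[/imset2P[a b Fa Fb ->]]|[[a b]]].
    by case/setX_sub/andP=> // sa sb; exists (a, b); rewrite // !inE Fa Fb sa.
  rewrite !inE /= => /andP[/andP[Fa sa] /andP[Fb sb]] ->.
  by split; [apply: imset2_f | apply: setXS].
rewrite card_in_imset ?cardsX // => -[a b] [a' b'].
rewrite !inE /= => /andP[/andP[Fa _] /andP[Fb _]] /andP[/andP[Fa' _] /andP[Fb' _]].
move=> eqX; have subXX C D : C = D :> {set Gamma * Delta} -> C \subset D.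
  by move->.
have/andP[sa sb] := setX_sub _ _ _ _ Fa Fb (subXX _ _ eqX).
have/andP[sa' sb'] := setX_sub _ _ _ _ Fa' Fb' (subXX _ _ (esym eqX)).
by congr (_, _); apply/eqP; rewrite eqEsubset ?sa ?sb.
Qed.

(** * The partition of a product *)

Section SamePart.

Variables (Gamma Delta : finType) (Pi : {set {set Gamma * Delta}}).

Definition same_part : rel (Gamma * Delta) := fun u v => v \in pblock Pi u.

Let E := same_part.
Let E' := flip_rel E.

Section Partition.

Hypothesis partPi : partition Pi [set: Gamma * Delta].

Let trivPi : trivIset Pi. Proof. by case/and3P: partPi. Qed.
Let in_cover u : u \in cover Pi. Proof. by rewrite (cover_partition partPi). Qed.

Lemma same_part_mem P u v : P \in Pi -> u \in P -> E u v = (v \in P).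
Proof. by move=> PiP Pu; rewrite /E /same_part (def_pblock trivPi PiP Pu). Qed.

Lemma same_part_eqv : equivalence_rel E.
Proof.
by move=> u v w; rewrite /E /same_part mem_pblock; split=> // /same_pblock ->.
Qed.

Lemma same_part_classes : eqclasses E = Pi.
Proof.
have pblockE u : eqclass E u = pblock Pi u by apply/setP=> v; rewrite inE.
apply/setP=> P; apply/eqclassesP/idP=> [[u ->]|PiP].
  by rewrite pblockE pblock_mem.
have /set0Pn[u Pu] : P != set0.
  by case/and3P: partPi => _ _; apply: contraNneq => <-.
by exists u; rewrite pblockE (def_pblock trivPi PiP Pu).
Qed.

Lemma part_eqclass P u : P \in Pi -> u \in P -> P = eqclass E u.
Proof. by rewrite -same_part_classes; apply/eqclasses_mem/same_part_eqv. Qed.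

Lemma eqclass_part u : eqclass E u \in Pi.
Proof. by rewrite -same_part_classes mem_eqclasses. Qed.

Lemma part_has_point P : P \in Pi -> exists u, P = eqclass E u.
Proof. by rewrite -same_part_classes => /eqclassesP. Qed.

End Partition.

Section Invariant.

Variables (G : {group {perm Gamma}}) (H : {group {perm Delta}}).
Hypothesis trG : [transitive G, on [set: Gamma] | 'P].
Hypothesis trH : [transitive H, on [set: Delta] | 'P].
Hypothesis invPi : invariant_partition (prod_action Gamma Delta) (setX G H) Pi.

Let partPi : partition Pi [set: Gamma * Delta]. Proof. by case/andP: invPi. Qed.

Lemma same_part_act g h x y x' y' : g \in G -> h \in H ->
  E (x, y) (x', y') -> E (g x, h y) (g x', h y').
Proof.
move=> Gg Hh Exy; case/andP: invPi => _ /actsP/(_ (g, h)).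
rewrite inE Gg Hh => /(_ isT (eqclass E (x, y))).
rewrite (eqclass_part partPi) => PiP.
have actP u : E (x, y) u ->
    (g u.1, h u.2) \in setact (prod_action _ _) (eqclass E (x, y)) (g, h).
  by move=> Eu; apply/imsetP; exists u; rewrite ?inE.
rewrite (same_part_mem partPi _ PiP); first exact: actP Exy.
by apply: (actP (x, y)); apply/eqv_refl/same_part_eqv.
Qed.

Lemma same_part_homogeneous : homogeneous E.
Proof.
split=> [|x z|y z]; first exact: same_part_eqv.
  have [g Gg ->] := atransP2 trG (in_setT x) (in_setT z).
  exists g => // -[? ?] [? ?] /(same_part_act Gg (group1 H)).
  by rewrite !perm1.
have [h Hh ->] := atransP2 trH (in_setT y) (in_setT z).
exists h => // -[? ?] [? ?] /(same_part_act (group1 G) Hh).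
by rewrite !perm1.
Qed.

End Invariant.

Section Induced.

Hypothesis partPi : partition Pi [set: Gamma * Delta].
Hypothesis homE : homogeneous E.
Variables (x0 : Gamma) (y0 : Delta).

Let homE' : homogeneous E' := homogeneous_flip homE.
Let eqvE : equivalence_rel E := same_part_eqv partPi.

Lemma projG_classes : projG Pi = eqclasses (proj_rel E).
Proof.
have projE x y :
    [set x' | [exists y', (x', y') \in eqclass E (x, y)]] = eqclass (proj_rel E) x.
  apply/setP=> x'; rewrite !inE; apply/existsP/idP=> [[y']|/(proj_at homE y)[y']].
    by rewrite inE; apply: proj_intro.
  by exists y'; rewrite inE.
apply/setP=> A; apply/imsetP/eqclassesP=> [[P PiP ->]|[x ->]].
  by have [[x y] ->] := part_has_point partPi PiP; exists x.
by exists (eqclass E (x, y0)); rewrite ?eqclass_part ?projE.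
Qed.

Lemma projH_classes : projH Pi = eqclasses (proj_rel E').
Proof.
have projE x y :
    [set y' | [exists x', (x', y') \in eqclass E (x, y)]] = eqclass (proj_rel E') y.
  apply/setP=> y'; rewrite !inE; apply/existsP/idP=> [[x']|/(proj_at homE' x)[x']].
    by rewrite inE => Exy; apply: (@proj_intro _ _ E' x x').
  by move=> Exy; exists x'; rewrite inE.
apply/setP=> A; apply/imsetP/eqclassesP=> [[P PiP ->]|[y ->]].
  by have [[x y] ->] := part_has_point partPi PiP; exists y.
by exists (eqclass E (x0, y)); rewrite ?eqclass_part ?projE.
Qed.

Lemma fibreG_classes : fibreG Pi y0 = eqclasses (fibre_rel E y0).
Proof.
have fibE x : [set x' | (x', y0) \in eqclass E (x, y0)] = eqclass (fibre_rel E y0) x.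
  by apply/setP=> x'; rewrite !inE.
apply/setP=> A; rewrite in_setD1; apply/andP/eqclassesP=> [[/set0Pn[x]]|[x ->]].
  move=> Ax /imsetP[P PiP AE]; exists x; rewrite -fibE AE.
  by rewrite -(part_eqclass partPi PiP) //; move: Ax; rewrite AE inE.
split; first by apply/set0Pn; exists x; apply/mem_eqclass/(fibre_eqv homE).
by apply/imsetP; exists (eqclass E (x, y0)); rewrite ?eqclass_part ?fibE.
Qed.

Lemma fibreH_classes : fibreH Pi x0 = eqclasses (fibre_rel E' x0).
Proof.
have fibE y : [set y' | (x0, y') \in eqclass E (x0, y)] = eqclass (fibre_rel E' x0) y.
  by apply/setP=> y'; rewrite !inE.
apply/setP=> B; rewrite in_setD1; apply/andP/eqclassesP=> [[/set0Pn[y]]|[y ->]].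
  move=> By /imsetP[P PiP BE]; exists y; rewrite -fibE BE.
  by rewrite -(part_eqclass partPi PiP) //; move: By; rewrite BE inE.
split; first by apply/set0Pn; exists y; apply/mem_eqclass/(fibre_eqv homE').
by apply/imsetP; exists (eqclass E (x0, y)); rewrite ?eqclass_part ?fibE.
Qed.

End Induced.

End SamePart.

Theorem lemma2p6 (Gamma Delta : finType)
    (G : {group {perm Gamma}}) (H : {group {perm Delta}})
    (trG : [transitive G, on [set: Gamma] | 'P])
    (trH : [transitive H, on [set: Delta] | 'P])
    (Pi : {set {set Gamma * Delta}})
    (invPi : invariant_partition (prod_action Gamma Delta) (setX G H) Pi)
    (x0 : Gamma) (y0 : Delta) :
  let PG := projG Pi in
  let FG := fibreG Pi y0 in
  let PH := projH Pi in
  let FH := fibreH Pi x0 in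
  [/\ invariant_partition 'P G PG, invariant_partition 'P G FG & refines FG PG]
  /\ exists k : nat,
    [/\ (forall A, A \in PG -> #|FG ::&: A| = k)
          /\ (forall B, B \in PH -> #|FH ::&: B| = k),
        k = 1%N ->
          exists (Pi1 : {set {set Gamma}}) (Pi2 : {set {set Delta}}),
            [/\ invariant_partition 'P G Pi1, invariant_partition 'P H Pi2
              & Pi = cartesian_product Pi1 Pi2]
      & (1 < k)%N ->
          forall A B, A \in PG -> B \in PH ->
          [/\ #|cartesian_product FG FH ::&: setX A B| = (k ^ 2)%N,
              forall C, C \in cartesian_product FG FH ->
                exists! P, P \in Pi /\ C \subset P
            & forall P, P \in Pi -> P \subset setX A B ->
                (forall a, a \in FG ::&: A ->
                   exists! b, b \in FH ::&: B /\ setX a b \subset P)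
                /\ (forall b, b \in FH ::&: B ->
                   exists! a, a \in FG ::&: A /\ setX a b \subset P)]].
Proof.
have partPi : partition Pi [set: Gamma * Delta] by case/andP: invPi.
have homE := same_part_homogeneous trG trH invPi.
set E := same_part Pi in homE; have homE' := homogeneous_flip homE.
have eqvE : equivalence_rel E := same_part_eqv partPi.
have eqv_fG := fibre_eqv homE y0; have eqv_fH := fibre_eqv homE' x0.
have eqv_pG := proj_eqv homE y0; have eqv_pH := proj_eqv homE' x0.
have act1 g : g \in G -> forall x y x' y',
    E (x, y) (x', y') -> E (g x, y) (g x', y').
  move=> Gg x y x' y' /(same_part_act invPi Gg (group1 H)).
  by rewrite !perm1.
have act2 h : h \in H -> forall x y x' y',
    E (x, y) (x', y') -> E (x, h y) (x', h y').
  move=> Hh x y x' y' /(same_part_act invPi (group1 G) Hh).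
  by rewrite !perm1.
have invPG : invariant_partition 'P G (eqclasses (proj_rel E)).
  apply: eqclasses_invariant => // g x x' Gg /(proj_at homE y0)[y'] /(act1 _ Gg).
  exact: proj_intro.
have invPH : invariant_partition 'P H (eqclasses (proj_rel (flip_rel E))).
  apply: eqclasses_invariant => // h y y' Hh /(proj_at homE' x0)[x'] /(act2 _ Hh).
  exact: (@proj_intro _ _ (flip_rel E) x0 x' (h y) (h y')).
move=> PG FG PH FH.
have PGE : PG = eqclasses (proj_rel E) by apply: projG_classes.
have PHE : PH = eqclasses (proj_rel (flip_rel E)) by apply: projH_classes.
have FGE : FG = eqclasses (fibre_rel E y0) by apply: fibreG_classes.
have FHE : FH = eqclasses (fibre_rel (flip_rel E) x0) by apply: fibreH_classes.
move: PG FG PH FH PGE PHE FGE FHE => _ _ _ _ -> -> -> ->.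
split; first split=> //.
- by apply: eqclasses_invariant => // g x x' Gg; apply: act1.
- by apply: eqclasses_refine => //; apply: fibre_proj.
(* Every part of [PG] can be compared with one fixed part of [PH]. *)
pose k := #|eqclasses (fibre_rel (flip_rel E) x0)
             ::&: eqclass (proj_rel (flip_rel E)) y0|.
have cardG A : A \in eqclasses (proj_rel E) ->
    #|eqclasses (fibre_rel E y0) ::&: A| = k.
  by move=> projA; apply: card_fibre_parts => //; apply: mem_eqclasses.
have cardH B : B \in eqclasses (proj_rel (flip_rel E)) ->
    #|eqclasses (fibre_rel (flip_rel E) x0) ::&: B| = k.
  move=> projB; rewrite -(cardG (eqclass (proj_rel E) x0)) ?mem_eqclasses //.
  by apply/esym/card_fibre_parts => //; apply: mem_eqclasses.
exists k; split=> // [k1|_ A B projA projB].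
  exists (eqclasses (proj_rel E)), (eqclasses (proj_rel (flip_rel E))).
  split=> //; rewrite -{1}(same_part_classes partPi).
  by apply: (@product_of_single_cells _ _ _ homE x0 y0); rewrite -k1.
split=> [|C|P PiP sPAB].
- by rewrite card_cartesian_parts ?cardG ?cardH // ?set0_eqclasses.
- case/imset2P=> a b /eqclassesP[x ->] /eqclassesP[y ->] ->.
  exists (eqclass E (x, y)); split=> [|P [PiP]].
    by rewrite cell_sub // eqclass_part // eqv_refl.
  have [u ->] := part_has_point partPi PiP.
  rewrite cell_sub // => Eu; apply: eqclass_eq => //.
  by rewrite eqv_sym.
have [[x y] PE] := part_has_point partPi PiP.
have: (x, y) \in setX A B by apply: (subsetP sPAB); rewrite PE mem_eqclass.
rewrite inE => /andP[Ax By]; rewrite PE.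
rewrite (eqclasses_mem eqv_pG projA Ax) (eqclasses_mem eqv_pH projB By).
split=> [a|b]; first exact: (@latin_row _ _ _ homE x0 y0 (x, y)).
(* The columns of the square are the rows for the exchanged coordinates. *)
case/(@latin_row _ _ _ homE' y0 x0 (y, x))=> a [[Aa sa] uniq_a].
have flipX (c : {set Gamma}) : (setX c b \subset eqclass E (x, y))
    = (setX b c \subset eqclass (flip_rel E) (y, x)).
  apply/subsetP/subsetP=> sub [u v] /=; rewrite !inE => /andP[uin vin];
    by have := sub (v, u); rewrite !inE uin vin; apply.
exists a; split=> [|c [Ac sc]]; first by rewrite flipX.
by apply: uniq_a; rewrite -flipX.
Qed.
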